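(* For all positive integers $n,d$, the dimension of the moment variety $\mathcal{M}_{n,d}$ is $$\min\left\{\,nd-1,\ \binom{n+d-1}{d}-1\right\}.$$
   Context: Work over $\mathbb{C}$. The variety $\mathcal{M}_{n,d}\subset\mathbb{P}^{\binom{n+d-1}{d}-1}$ has coordinates $m_{i_1\cdots i_n}$, indexed by $(i_1,\ldots,i_n)\in\mathbb{Z}_{\ge0}^n$ with $i_1+\cdots+i_n=d$. It is the Zariski closure of the image of the monomial map $(\mu_{ki})_{k\in[n],i\in[d]}\mapsto(\mu_{1i_1}\mu_{2i_2}\cdots\mu_{ni_n})$, with the convention $\mu_{k0}=1$. *)

(* Defs.v *)
From Stdlib Require Import Reals.
From mathcomp Require Import all_boot all_algebra.
From mathcomp Require Import Rstruct.
From mathcomp Require Import complex.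
From mathcomp Require Import mpoly.

Set Implicit Arguments.
Unset Strict Implicit.
Unset Printing Implicit Defensive.
Import GRing.Theory.
Local Open Scope ring_scope.

Definition Cplx : closedFieldType := complex Rdefinitions.R.

(* Projective space P(C^J) over a finite coordinate set J, with its Zariski  *)
(* topology.  A point of P(C^J) is represented by any nonzero vector          *)
(* v : J -> C (its homogeneous coordinates); subsets of P(C^J) are           *)
(* represented by scaling-invariant sets of nonzero vectors.  Polynomials in  *)
(* the coordinates are elements of {mpoly C[#|J|]}, variable i standing for   *)
(* the coordinate enum_val i.                                                 *)

Section Proj.
Variable J : finType.

Definition pt := J -> Cplx.
Definition pset := pt -> Prop.

Definition nonzero (v : pt) : Prop := exists j, v j != 0.

Definition peval (p : {mpoly Cplx[#|J|]}) (v : pt) : Cplx :=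
  p.@[fun i : 'I_#|J| => v (enum_val i)].

Definition pclosed (S : pset) : Prop :=
  exists F : {mpoly Cplx[#|J|]} -> Prop,
    (forall p, F p -> exists k : nat, p \is k.-homog) /\
    (forall v, S v <-> (nonzero v /\ forall p, F p -> peval p v = 0)).

Definition psubset (A B : pset) : Prop := forall v, A v -> B v.
Definition pproper (A B : pset) : Prop := psubset A B /\ exists v, B v /\ ~ A v.

Definition pclosure (A : pset) : pset :=
  fun v => forall S, pclosed S -> psubset A S -> S v.

Definition pirreducible (Z : pset) : Prop :=
  pclosed Z /\ (exists v, Z v) /\
  forall Z1 Z2, pclosed Z1 -> pclosed Z2 -> psubset Z (fun v => Z1 v \/ Z2 v) ->
    psubset Z Z1 \/ psubset Z Z2.

Definition has_chain (X : pset) (k : nat) : Prop :=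
  exists Z : nat -> pset,
    (forall i, (i <= k)%N -> pirreducible (Z i) /\ psubset (Z i) X) /\
    (forall i, (i < k)%N -> pproper (Z i) (Z i.+1)).

Definition pdim_eq (X : pset) (D : nat) : Prop :=
  has_chain X D /\ ~ has_chain X D.+1.

End Proj.

Definition midx (n d : nat) : finType :=
  {t : n.-tuple 'I_d.+1 | (\sum_(k < n) (tnth t k : nat) == d)%N}.

(* The monomial map: mu k i (k in [n], i in {0..d}) with the convention
   mu k 0 = 1; coordinate m_{i_1..i_n} = mu_{1 i_1} ... mu_{n i_n}. *)
Definition moment_map (n d : nat) (mu : 'I_n -> 'I_d.+1 -> Cplx) : pt (midx n d) :=
  fun a => \prod_(k < n) mu k (tnth (val a) k).

(* The image of the monomial map in P(C^(midx n d)) (at the parameters where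
   the image vector is nonzero, i.e. where the map defines a point). *)
Definition moment_image (n d : nat) : pset (midx n d) :=
  fun v => exists (mu : 'I_n -> 'I_d.+1 -> Cplx) (c : Cplx),
    (forall k, mu k ord0 = 1) /\ c != 0 /\ nonzero (moment_map mu) /\
    (forall a, v a = c * moment_map mu a).

Definition moment_variety (n d : nat) : pset (midx n d) :=
  @pclosure (midx n d) (@moment_image n d).

Arguments moment_image : clear implicits.
Arguments moment_variety : clear implicits.

(* Main.v *)
(* Upper bound: given a chain Z_0 < ... < Z_k in the closure of a set parametrised by r
   polynomial parameters, pick forms f_i vanishing on Z_(i-1) but not on Z_i (f_0 a coordinate).
   As Z_i is irreducible, the m^(k+1) monomials in f_0, ..., f_k with exponents < m are linearly
   independent on Z_k.  They pull back to polynomials of degree O(m) in r variables, so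
   m^(k+1) = O(m^r) and k < r.  The affine cone over the moment variety is parametrised by the
   nd variables mu_ki, the scale being absorbed by mu_ki -> lam^i mu_ki; for n <= 2 the
   coordinates themselves are at most d+1 parameters.

   Lower bound: free the parameters one at a time.  The closures of the resulting torus images
   are irreducible, and they increase strictly because of binomials X^al - X^be whose exponents
   come from the linear independence of the rows of the exponent matrix together with the row of
   ones.  For n >= 3 this independence, with one parameter dropped, says that functions f_k on
   [0..d] with f_k(0) = 0 and sum_k f_k(a_k) constant on compositions a of d, one of them
   vanishing at d, are all zero. *)
Require Import Defs.
From Stdlib Require Import Reals.
From mathcomp Require Import all_boot all_algebra.
From mathcomp Require Import Rstruct complex mpoly.
From mathcomp Require Import zify.
From Stdlib Require Import Classical.

Section MomentVariety.
Set Implicit Arguments.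
Unset Strict Implicit.
Unset Printing Implicit Defensive.
Import GRing.Theory Num.Theory.
Local Open Scope ring_scope.

(** * Polynomial identities over closed fields and homogeneous components *)

Lemma poly_eq0_torus (F : closedFieldType) (Q : {poly F}) :
  (forall x, x != 0 -> Q.[x] = 0) -> Q = 0.
Proof.
move=> Q0; apply/eqP; apply: contraT => nzQ.
(* A non-root of ['X * Q] is a nonzero point at which [Q] does not vanish. *)
have /closed_nonrootP[x] : 'X * Q != 0 by rewrite mulf_neq0 ?polyX_eq0.
rewrite rootE hornerM hornerX mulf_eq0 negb_or => /andP[x0].
by rewrite Q0 ?eqxx.
Qed.

Lemma exists_expr_eq (F : closedFieldType) (n : nat) (c : F) :
  (0 < n)%N -> exists x : F, x ^+ n = c.
Proof.
move=> n0; have [x xE] := solve_monicpoly (fun i => if i == 0%N then c else 0) n0.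
exists x; rewrite {}xE; case: n n0 => // n _; rewrite big_ord_recl /= mulr1.
by rewrite big1 ?addr0 // => i _; rewrite mul0r.
Qed.

Lemma meval_curve (F : comNzRingType) n (q : {mpoly F[n]}) (h : 'I_n -> {poly F}) :
  exists P : {poly F}, forall s, q.@[fun i => (h i).[s]] = P.[s].
Proof.
exists (\sum_(m <- msupp q) q@_m *: \prod_i h i ^+ m i) => s.
rewrite mevalE horner_sum; apply: eq_bigr => m _; rewrite hornerZ horner_prod.
by congr (_ * _); apply: eq_bigr => i _; rewrite horner_exp.
Qed.

Lemma meval_homogZ (F : comNzRingType) n k (p : {mpoly F[n]}) (c : F) v :
  p \is k.-homog -> p.@[fun i => c * v i] = c ^+ k * p.@[v].
Proof.
move=> /dhomogP hp; rewrite !mevalE mulr_sumr big_seq [RHS]big_seq.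
apply: eq_bigr => m /hp mk; rewrite mulrCA; congr (_ * _).
rewrite -(mk : mdeg m = k) mdegE expr_sum -big_split /=.
by apply: eq_bigr => i _; rewrite exprMn.
Qed.

(** Along the line through [v], [q] is a polynomial in the scale [c] whose coefficients are the
    values at [v] of the homogeneous components. It vanishes for all nonzero [c], so every
    coefficient is zero. *)
Lemma meval_pihomog_eq0 (F : closedFieldType) n (q : {mpoly F[n]}) v :
  (forall c, c != 0 -> q.@[fun i => c * v i] = 0) ->
  forall s, (pihomog mdeg s q).@[v] = 0.
Proof.
move=> q0 s; pose k := maxn (msize q) s.+1.
pose Q := \poly_(i < k) (pihomog mdeg i q).@[v].
suff Q0 : Q = 0.
  by have := coef0 F s; rewrite -Q0 coef_poly /k leq_max ltnS leqnn orbT.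
apply: poly_eq0_torus => x x0; rewrite -{}[RHS](q0 _ x0) horner_poly.
have -> : q = \sum_(i < k) pihomog mdeg i q.
  by apply: pihomog_partitionE; rewrite leq_maxl.
rewrite raddf_sum /=; apply: eq_bigr => i _; rewrite -pihomog_partitionE ?leq_maxl //.
by rewrite (meval_homogZ _ _ (pihomogP mdeg i q)) mulrC.
Qed.

(** * Closed sets, closures and irreducibility in projective space *)

Section Projective.
Variable J : finType.
Implicit Types (A Z W X : pset J) (v w : pt J) (p q f : {mpoly Cplx[#|J|]}).

Definition vanishes q Z := forall v, Z v -> peval q v = 0.

(** Linear independence modulo the polynomials vanishing on [Z], that is, in the coordinate ring of
    the cone [Z]. *)
Definition indep Z (I : finType) (g : I -> {mpoly Cplx[#|J|]}) :=
  forall c : I -> Cplx, vanishes (\sum_i c i *: g i) Z -> forall i, c i = 0.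

Definition conic Z :=
  forall v (c : Cplx), Z v -> c != 0 -> Z (fun j => c * v j).

Lemma peval_homogZ k p (c : Cplx) v :
  p \is k.-homog -> peval p (fun j => c * v j) = c ^+ k * peval p v.
Proof. by move=> hp; rewrite /peval -(meval_homogZ _ _ hp). Qed.

Lemma pclosed_nonzero Z v : pclosed Z -> Z v -> Defs.nonzero v.
Proof. by move=> [F [_ FZ]] /FZ[]. Qed.

Lemma pclosed_conic Z : pclosed Z -> conic Z.
Proof.
move=> [F [hF FZ]] v c /FZ[[j vj] Fv] c0; apply/FZ; split.
  by exists j; rewrite mulf_neq0.
by move=> p Fp; have [k hk] := hF _ Fp; rewrite (peval_homogZ _ _ hk) Fv ?mulr0.
Qed.

Lemma pclosed_hypersurface k p :
  p \is k.-homog -> pclosed (fun v : pt J => Defs.nonzero v /\ peval p v = 0).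
Proof.
move=> hp; exists (eq p); split=> [q <-|v]; first by exists k.
split=> -[nzv pv]; split=> //; first by move=> q <-.
exact: pv.
Qed.

Lemma vanishes_pihomog Z q s :
  conic Z -> vanishes q Z -> vanishes (pihomog mdeg s q) Z.
Proof.
move=> cZ q0 v Zv; apply: meval_pihomog_eq0 => c c0; exact: q0 (cZ _ _ Zv c0).
Qed.

Lemma vanishes_from_pihomog Z q :
  (forall s, vanishes (pihomog mdeg s q) Z) -> vanishes q Z.
Proof.
move=> q0 v Zv; rewrite (pihomog_partitionE (leqnn (msize q))) /peval raddf_sum.
by apply: big1 => i _; apply: q0.
Qed.

(** The common zeros of all forms vanishing on [A] are themselves a closed set containing [A], and
    every closed set containing [A] is cut out by some of these forms. *)
Lemma pclosureE A v : (forall w, A w -> Defs.nonzero w) ->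
  (pclosure A v <-> Defs.nonzero v /\
   forall k p, p \is k.-homog -> vanishes p A -> peval p v = 0).
Proof.
move=> nzA; split=> [clv|[nzv v0] Z Zcl AZ].
  pose S w := Defs.nonzero w /\
    forall k p, p \is k.-homog -> vanishes p A -> peval p w = 0.
  apply: (clv S) => [|w Aw]; last first.
    split=> [|k p _ pA]; [exact: nzA Aw | exact: pA].
  exists (fun p => (exists k, p \is k.-homog) /\ vanishes p A).
  split=> [p []//|w]; split=> -[nzw w0]; split=> //.
    by move=> p [[k hp] pA]; apply: w0 hp pA.
  by move=> k p hp pA; apply: w0; split=> //; exists k.
case: (Zcl) => F [hF FZ]; apply/FZ; split=> // p Fp.
have [k hk] := hF _ Fp; apply: v0 hk _ => w /AZ/FZ[_]; exact.
Qed.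

Lemma pclosed_pclosure A : (forall w, A w -> Defs.nonzero w) -> pclosed (pclosure A).
Proof.
move=> nzA; exists (fun p => (exists k, p \is k.-homog) /\ vanishes p A).
split=> [p []//|w]; rewrite pclosureE //.
split=> -[nzw w0]; split=> //.
  by move=> p [[k hp] pA]; apply: w0 hp pA.
by move=> k p hp pA; apply: w0; split=> //; exists k.
Qed.

Lemma sub_pclosure A : psubset A (pclosure A).
Proof. by move=> v Av Z _; apply. Qed.

Lemma pclosure_sub A Z : pclosed Z -> psubset A Z -> psubset (pclosure A) Z.
Proof. by move=> Zcl AZ v; apply. Qed.

Lemma vanishes_pclosure A q : (forall w, A w -> Defs.nonzero w) -> conic A ->
  vanishes q A -> vanishes q (pclosure A).
Proof.
move=> nzA cA q0; apply: vanishes_from_pihomog => s v /(pclosureE _ nzA)[_].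
by apply; [exact: pihomogP | exact: vanishes_pihomog].
Qed.

(** Where [f] is nonzero at [v], it is nonzero on the whole punctured line, so [q] and hence each of
    its components vanishes there. Thus [Z] is covered by [f = 0] and the hypersurface of any one
    component of [q]; irreducibility and the point with [f] nonzero leave only the latter. *)
Lemma irreducible_prime Z k f q : pirreducible Z -> f \is k.-homog ->
  (exists v, Z v /\ peval f v != 0) -> vanishes (f * q) Z -> vanishes q Z.
Proof.
move=> [Zcl [_ Zirr]] hf [u [Zu fu]] fq0; have cZ := pclosed_conic Zcl.
apply: vanishes_from_pihomog => s.
have := Zirr _ _ (pclosed_hypersurface hf)
                 (pclosed_hypersurface (pihomogP mdeg s q)).
case=> [v Zv|Zf|Zq].
- have nzv := pclosed_nonzero Zcl Zv.
  have [fv|fv] := eqVneq (peval f v) 0; [by left | right; split=> //].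
  apply: meval_pihomog_eq0 => c c0; have := fq0 _ (cZ _ _ Zv c0).
  rewrite {1}/peval mevalM => /eqP; rewrite mulf_eq0 => /orP[|/eqP//].
  move: (peval_homogZ c v hf); rewrite {1}/peval => ->.
  by rewrite mulf_eq0 (negPf fv) expf_eq0 (negPf c0) andbF.
- by have [_] := Zf _ Zu; move/eqP; rewrite (negPf fu).
- by move=> v /Zq[].
Qed.

Lemma irreducible_prime_exp Z k f q j : pirreducible Z -> f \is k.-homog ->
  (exists v, Z v /\ peval f v != 0) -> vanishes (f ^+ j * q) Z -> vanishes q Z.
Proof.
move=> Zirr hf nzf; elim: j => [|j IHj]; first by rewrite mul1r.
by rewrite exprS -mulrA => /(irreducible_prime Zirr hf nzf).
Qed.

(** Strong induction on the exponent of [f]: once the lower coefficients are zero, primality removes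
    the common power of [f], and restriction to [W] kills every remaining positive power. What is
    left is a relation among the [g i] on [W]. *)
Lemma indep_extend Z W k f (I : finType) (g : I -> {mpoly Cplx[#|J|]}) m :
  pirreducible Z -> f \is k.-homog -> (exists v, Z v /\ peval f v != 0) ->
  vanishes f W -> (forall q, vanishes q Z -> vanishes q W) -> indep W g ->
  indep Z (fun x : I * 'I_m => g x.1 * f ^+ x.2).
Proof.
move=> Zirr hf nzf fW ZW gW c c0.
suff H j : forall i (l : 'I_m), l = j :> nat -> c (i, l) = 0.
  by case=> i l; apply: (H l).
elim/ltn_ind: j => j IHj i l lj.
(* The relation divided by [f ^+ j]; truncated subtraction makes the explicit zero for exponents
   below [j] necessary. *)
pose q := \sum_(x : I * 'I_m)
  (if (x.2 < j)%N then 0 else c x *: (g x.1 * f ^+ (x.2 - j))).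
have qZ : vanishes q Z.
  apply: (@irreducible_prime_exp _ _ f _ j Zirr hf nzf).
  suff -> : f ^+ j * q = \sum_x c x *: (g x.1 * f ^+ x.2) by [].
  rewrite mulr_sumr; apply: eq_bigr => -[x y] _ /=.
  case: ltnP => [yj|jy]; first by rewrite (IHj _ yj) // mulr0 scale0r.
  by rewrite -scalerAr mulrCA -exprD subnKC.
apply: (gW (fun i => c (i, l))) => w Ww; rewrite -[RHS](ZW _ qZ w Ww).
pose G (x : I) (y : 'I_m) := if (y < j)%N then 0
  else c (x, y) * (peval (g x) w * peval f w ^+ (y - j)).
rewrite /peval /q !raddf_sum /= (eq_bigr (fun x => G x.1 x.2)); last first.
  move=> [x y] _ /=; rewrite /G; case: ifP => _; first by rewrite meval0.
  by rewrite mevalZ mevalM rmorphXn.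
rewrite -(pair_bigA _ G) /=; apply: eq_bigr => x _.
rewrite (bigD1 l) //= {1}/G lj ltnn subnn mulr1 mevalZ big1 ?addr0 // => y yl.
rewrite /G (fW _ Ww); case: ltnP => // jy.
have : (0 < y - j)%N by rewrite subn_gt0 ltn_neqAle jy -lj eq_sym andbT.
by case: (y - j)%N => // t _; rewrite expr0n !mulr0.
Qed.

End Projective.

(** * Linear dependence of polynomials of bounded degree *)

Lemma card_bmultinom_le r b : (#|{: 'X_{1..r < b.+1}}| <= b.+1 ^ r)%N.
Proof.
pose e (m : 'X_{1..r < b.+1}) : {ffun 'I_r -> 'I_b.+1} := [ffun i => inord (m i)].
suff /leq_card : injective e by rewrite card_ffun !card_ord.
move=> m1 m2 /ffunP e12; apply/val_inj/mnmP => i.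
have lt (m : 'X_{1..r < b.+1}) : (m i < b.+1)%N.
  by apply: leq_ltn_trans (bmdeg m); rewrite mdegE (bigD1 i) //= leq_addr.
by have := congr1 val (e12 i); rewrite !ffunE /= !inordK.
Qed.

(** There are at most [b.+1 ^ r] monomials of degree at most [b], so the coefficient matrix has more
    rows than its rank and a nonzero left kernel. *)
Lemma mpoly_dependent (F : fieldType) r b (I : finType) (G : I -> {mpoly F[r]}) :
  (forall i, (msize (G i) <= b.+1)%N) -> (b.+1 ^ r < #|I|)%N ->
  exists c : I -> F, \sum_i c i *: G i = 0 /\ exists i, c i != 0.
Proof.
move=> sG ltI.
pose M : 'M[F]_(#|I|, #|{: 'X_{1..r < b.+1}}|) :=
  \matrix_(i, k) (G (enum_val i))@_(bmnm (enum_val k)).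
have : kermx M != 0.
  rewrite kermx_eq0 /row_free neq_ltn; apply/orP; left.
  by apply: leq_ltn_trans (rank_leq_col M) (leq_ltn_trans _ ltI); exact: card_bmultinom_le.
case/rowV0Pn => v /sub_kermxP vM nzv.
exists (fun i => v 0 (enum_rank i)); split; last first.
  have /existsP[k vk] : [exists k, v 0 k != 0].
    apply: contraNT nzv; rewrite negb_exists => /forallP v0.
    by apply/eqP/rowP => k; rewrite mxE; apply/eqP; rewrite -[_ == _]negbK.
  by exists (enum_val k); rewrite enum_valK.
apply/mpolyP => m; rewrite mcoeff0 raddf_sum /=.
have [mb|bm] := ltnP (mdeg m) b.+1; last first.
  apply: big1 => i _; rewrite mcoeffZ memN_msupp_eq0 ?mulr0 //.
  by apply: msize_mdeg_ge; apply: leq_trans (sG i) bm.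
have /rowP/(_ (enum_rank (BMultinom mb))) := vM.
rewrite !mxE => vm; rewrite -[RHS]vm [RHS](reindex (@enum_rank I)) /=; last first.
  by exists enum_val => i _; rewrite ?enum_valK ?enum_rankK.
by apply: eq_bigr => i _; rewrite mcoeffZ mxE !enum_rankK.
Qed.

Lemma msizeM_leS (F : idomainType) r (p q : {mpoly F[r]}) a b :
  (msize p <= a.+1 -> msize q <= b.+1 -> msize (p * q) <= (a + b).+1)%N.
Proof.
have [->|p0] := eqVneq p 0; first by rewrite mul0r msize0.
have [->|q0] := eqVneq q 0; first by rewrite mulr0 msize0.
rewrite msizeM //; lia.
Qed.

Lemma msizeX_leS (F : idomainType) r (p : {mpoly F[r]}) a j :
  (msize p <= a.+1 -> msize (p ^+ j) <= (a * j).+1)%N.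
Proof.
move=> pa; elim: j => [|j IHj]; first by rewrite expr0 msize1.
by rewrite exprS mulnS; apply: msizeM_leS.
Qed.

(** * Upper bound on chain lengths by counting parameters *)

Section ChainBound.
Variables (J : finType) (r : nat) (phi : #|J|.-tuple {mpoly Cplx[r]}).
Implicit Types (A Z W : pset J).

(** A Hilbert-function lower bound of order [e]. Since [msize] is the degree plus one, the pullbacks
    along [phi] have degree at most [K * m]. *)
Definition indep_growth Z e := exists K, forall m, exists (I : finType)
  (g : I -> {mpoly Cplx[#|J|]}), [/\ #|I| = (m ^ e)%N, indep Z g &
    forall x, (msize (g x \mPo phi) <= (K * m).+1)%N].

Lemma indep_growth_extend Z W k f e :
  pirreducible Z -> f \is k.-homog -> (exists v, Z v /\ peval f v != 0) ->
  vanishes f W -> (forall q, vanishes q Z -> vanishes q W) ->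
  indep_growth W e -> indep_growth Z e.+1.
Proof.
move=> Zirr hf nzf fW ZW [K HK]; pose D := msize (f \mPo phi).
exists (K + D)%N => m; have [I [g [cI gW sg]]] := HK m.
exists (I * 'I_m)%type, (fun x : I * 'I_m => g x.1 * f ^+ x.2); split.
- by rewrite card_prod cI card_ord expnSr.
- exact: (indep_extend Zirr hf nzf fW ZW gW).
move=> [x j] /=; rewrite rmorphM rmorphXn /=.
have := msizeM_leS (sg x) (msizeX_leS j (leqnSn D)).
move/leq_trans; apply; rewrite ltnS mulnDl leq_add2l leq_mul2l.
by rewrite [(j <= m)%N]ltnW ?orbT.
Qed.

(** The origin is the cone over the empty set; it serves as the bottom of the chain, where the
    constant 1 is independent. *)
Lemma indep_growth_origin : indep_growth (fun v : pt J => forall j, v j = 0) 0.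
Proof.
exists 0%N => m; exists unit, (fun=> 1); split; first by rewrite card_unit.
  move=> c /(_ (fun=> 0) (fun=> erefl)).
  rewrite (big_pred1 tt) => [|[]//].
  by rewrite /peval mevalZ meval1 mulr1 => c0 [].
by move=> _; rewrite comp_mpoly1 msize1.
Qed.

(** On the line through a point of [Z], [q] is a univariate polynomial that is zero at every nonzero
    parameter, hence also at 0. *)
Lemma vanishes_origin Z q : pclosed Z -> (exists v, Z v) -> vanishes q Z ->
  vanishes q (fun v : pt J => forall j, v j = 0).
Proof.
move=> Zcl [v Zv] qZ w w0.
have [P PE] := meval_curve q (fun i => v (enum_val i) *: 'X).
suff P0 : P = 0.
  have := PE 0; rewrite P0 horner0 => <-; apply: meval_eq => i.
  by rewrite hornerZ hornerX mulr0 w0.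
apply: poly_eq0_torus => x x0; rewrite -PE -[RHS](qZ _ (pclosed_conic Zcl Zv x0)).
by apply: meval_eq => i; rewrite hornerZ hornerX mulrC.
Qed.

Lemma indep_growth_irreducible Z : pirreducible Z -> indep_growth Z 1.
Proof.
move=> Zirr; have [Zcl [Zne _]] := Zirr.
have [v Zv] := Zne; have [a va] := pclosed_nonzero Zcl Zv.
have ev w : peval 'X_(enum_rank a) w = w a by rewrite /peval mevalXU enum_rankK.
apply: (@indep_growth_extend _ (fun v => forall j, v j = 0) 1 'X_(enum_rank a)) => //.
- by rewrite dhomogX; apply/eqP; exact: mdeg1.
- by exists v; rewrite ev.
- by move=> w w0; rewrite ev.
- by move=> q; apply: vanishes_origin.
- exact: indep_growth_origin.
Qed.

Lemma pclosed_separate Z v : pclosed Z -> Defs.nonzero v -> ~ Z v ->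
  exists k f, [/\ f \is k.-homog, vanishes f Z & peval f v != 0].
Proof.
move=> [F [hF FZ]] nzv nZv.
have [f [Ff fv]] : exists f, F f /\ peval f v != 0.
  apply: NNPP => nf; apply: nZv; apply/FZ; split=> // p Fp.
  by apply/eqP/negP => /negP pv; apply: nf; exists p.
by have [k hf] := hF _ Ff; exists k, f; split=> // w /FZ[_]; apply.
Qed.

Lemma chain_length_lt A k : (forall w, A w -> Defs.nonzero w) -> conic A ->
  (forall v, A v -> exists t : 'I_r -> Cplx,
     forall a, v a = (tnth phi (enum_rank a)).@[t]) ->
  has_chain (pclosure A) k -> (k < r)%N.
Proof.
move=> nzA cA Aphi [Z [Zirr Zlt]].
have growth i : (i <= k)%N -> indep_growth (Z i) i.+1.
  elim: i => [|i IHi] ik; first by apply: indep_growth_irreducible; have [] := Zirr _ ik.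
  have [Zi _] := Zirr _ ik; have [[Wcl _] _] := Zirr _ (ltnW ik).
  have [WZ [v [Zv nWv]]] := Zlt _ ik.
  have [e [f [hf fW fv]]] := pclosed_separate Wcl (pclosed_nonzero Zi.1 Zv) nWv.
  have nzf : exists v, Z i.+1 v /\ peval f v != 0 by exists v.
  apply: (indep_growth_extend Zi hf nzf fW _ (IHi (ltnW ik))) => q qZ w Ww.
  by apply/qZ/WZ.
have [K HK] := growth k (leqnn k); have [_ ZA] := Zirr _ (leqnn k).
have card_le m : (m ^ k.+1 <= (K * m).+1 ^ r)%N.
  have [I [g [<- gZ sg]]] := HK m.
  (* Too many pullbacks would be linearly dependent; the relation then vanishes on [A], so on its
     closure and on [Z k], against independence. *)
  rewrite leqNgt; apply/negP => /(mpoly_dependent sg)[c [c0 [i /eqP]]]; apply.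
  apply: gZ => v /ZA; apply: vanishes_pclosure => // w /Aphi[t wt].
  have := congr1 (meval t) c0; rewrite meval0 => <-.
  rewrite /peval !raddf_sum /=; apply: eq_bigr => x _.
  rewrite !mevalZ comp_mpoly_meval; congr (_ * _); apply: meval_eq => j.
  by rewrite wt enum_valK.
(* This [m] breaks the count: [(K * m).+1 ^ r <= (K.+1 * m) ^ r < m ^ r.+1 <= m ^ k.+1]. *)
rewrite ltnNge; apply/negP => rk; pose m := (K.+1 ^ r).+1.
have := card_le m; apply/negP; rewrite -ltnNge.
apply: (@leq_ltn_trans ((K.+1 * m) ^ r)).
  have [r0|r0] := posnP r; first by rewrite [X in (_ ^ X <= _ ^ X)%N]r0.
  by rewrite leq_exp2r // mulSn -addn1 addnC leq_add2r.
rewrite expnMn; apply: (@leq_trans (m ^ r.+1)); last by rewrite leq_pexp2l.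
by rewrite expnS ltn_mul2r expn_gt0 /= ltnSn.
Qed.

End ChainBound.

(** * Linear algebra for binomial exponents, and irreducibility by curves *)

Lemma separating_functional (F : fieldType) (I J : finType)
    (M : I -> J -> F) (b : J -> F) :
  (forall w : I -> F, exists j, \sum_i w i * M i j != b j) ->
  exists u : J -> F, (forall i, \sum_j M i j * u j = 0) /\ \sum_j b j * u j != 0.
Proof.
move=> nspan.
pose B : 'M[F]_(#|I|, #|J|) := \matrix_(i, j) M (enum_val i) (enum_val j).
pose r : 'rV[F]_#|J| := \row_j b (enum_val j).
(* [b] lies outside the row space of [M], so some column of the cokernel kills all rows of [M] but
   not [b]. *)
have : ~~ (r <= B)%MS.
  apply/negP => /submxP[D rD]; have [j] := nspan (fun i => D 0 (enum_rank i)).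
  apply/negP; rewrite negbK; apply/eqP.
  have /rowP/(_ (enum_rank j)) := rD; rewrite !mxE enum_rankK => ->.
  rewrite (reindex (@enum_rank I)) /=; last first.
    by exists enum_val => i _; rewrite ?enum_valK ?enum_rankK.
  by apply: eq_bigr => i _; rewrite mxE !enum_rankK.
rewrite submxE => nz.
have [k rk] : exists k, (r *m cokermx B) 0 k != 0.
  apply/existsP; apply: contraNT nz; rewrite negb_exists => /forallP r0.
  by apply/eqP/rowP => k; rewrite [RHS]mxE; apply/eqP; rewrite -[_ == _]negbK.
exists (fun j => cokermx B (enum_rank j) k); split=> [i|]; last first.
  apply: contraNneq rk => bu; rewrite mxE (reindex (@enum_rank J)) /=; last first.
    by exists enum_val => j _; rewrite ?enum_valK ?enum_rankK.
  by apply/eqP; rewrite -[RHS]bu; apply: eq_bigr => j _; rewrite mxE enum_rankK.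
have /matrixP/(_ (enum_rank i) k) := mulmx_coker B.
rewrite !mxE => Bu; rewrite -[RHS]Bu [RHS](reindex (@enum_rank J)) /=; last first.
  by exists enum_val => j _; rewrite ?enum_valK ?enum_rankK.
by apply: eq_bigr => j _; rewrite [B _ _]mxE !enum_rankK.
Qed.

Lemma clear_denominators (J : finType) (u : J -> rat) :
  exists (c : rat) (al be : J -> nat), c != 0 /\
    forall j, c * u j = (al j)%:R - (be j)%:R.
Proof.
(* The scale is the product of all denominators; [al] and [be] are the positive and negative parts
   of the integers [z j]. *)
pose z j := numq (u j) * \prod_(k | k != j) denq (u k).
exists (\prod_k (denq (u k))%:~R),
  (fun j => if z j is Posz m then m else 0%N),
  (fun j => if z j is Negz m then m.+1 else 0%N); split=> [|j].
  by apply/prodf_neq0 => k _; rewrite intr_eq0 denq_neq0.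
transitivity ((z j)%:~R : rat); last first.
  by case: (z j) => m; rewrite ?NegzE ?subr0 ?sub0r ?mulrNz.
rewrite (bigD1 j) //= mulrAC [_ * u j]mulrC -numqE /z rmorphM rmorph_prod /=.
by [].
Qed.

Lemma exists_expr_neq (F : closedFieldType) (m n : nat) : m != n ->
  exists y : F, y != 0 /\ y ^+ m != y ^+ n.
Proof.
move=> mn; apply: NNPP => no.
have /eqP : 'X^m - 'X^n = 0 :> {poly F}.
  apply: poly_eq0_torus => y y0; rewrite hornerD hornerN !hornerXn.
  by apply/eqP; rewrite subr_eq0; apply/negP => /negP yy; apply: no; exists y.
rewrite subr_eq0 => /eqP/(congr1 (fun p : {poly F} => size p)).
by rewrite !size_polyXn => -[] /eqP; rewrite (negPf mn).
Qed.

(* If the closure were covered by two closed sets, neither containing [A], restrict two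
   separating forms to a rational curve through the points where they do not vanish:
   irreducibility reduces to [{poly Cplx}] being a domain. *)
Lemma pirreducible_pclosure (J : finType) (A : pset J) :
  (forall w, A w -> Defs.nonzero w) -> (exists v, A v) ->
  (forall v w, A v -> A w -> exists (h : J -> {poly Cplx}) (R : {poly Cplx}),
     [/\ R != 0, forall a, v a = (h a).[0], forall a, w a = (h a).[1] &
         forall s, R.[s] != 0 -> A (fun a => (h a).[s])]) ->
  pirreducible (pclosure A).
Proof.
move=> nzA [v0 Av0] curve; split; first exact: pclosed_pclosure.
split=> [|Z1 Z2 cl1 cl2 sub12]; first by exists v0; apply: sub_pclosure.
suff : psubset A Z1 \/ psubset A Z2.
  by case=> AZ; [left|right]; apply: pclosure_sub.
apply: NNPP => /not_or_and[n1 n2].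
have [v {}n1] := not_all_ex_not _ _ n1; have [Av nv] := imply_to_and _ _ n1.
have [w {}n2] := not_all_ex_not _ _ n2; have [Aw nw] := imply_to_and _ _ n2.
have [_ [p [_ pZ pv]]] := pclosed_separate cl1 (nzA _ Av) nv.
have [_ [q [_ qZ qw]]] := pclosed_separate cl2 (nzA _ Aw) nw.
have [h [R [R0 hv hw hA]]] := curve _ _ Av Aw.
have [P PE] := meval_curve p (fun i => h (enum_val i)).
have [Q QE] := meval_curve q (fun i => h (enum_val i)).
have P0 : P != 0.
  apply: contraNneq pv => P0; rewrite -[eqbRHS](horner0 0) -P0 -PE.
  by apply/eqP/meval_eq => i; rewrite hv.
have Q0 : Q != 0.
  apply: contraNneq qw => Q0; rewrite -[eqbRHS](horner0 1) -Q0 -QE.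
  by apply/eqP/meval_eq => i; rewrite hw.
have /closed_nonrootP[s] : P * Q * R != 0 by rewrite !mulf_neq0.
rewrite rootE !hornerM !mulf_eq0 !negb_or -andbA => /and3P[Ps Qs Rs].
have [hs|hs] := sub12 _ (sub_pclosure (hA _ Rs)).
  by move: Ps; rewrite -PE; move: (pZ _ hs); rewrite /peval => ->; rewrite eqxx.
by move: Qs; rewrite -QE; move: (qZ _ hs); rewrite /peval => ->; rewrite eqxx.
Qed.

(** * Strictly increasing chains of torus closures *)

Section ToricChain.
Variables (J T : finType) (E : J -> T -> nat) (l : seq T).

(** Only the first [j] parameters of [l] are free, the others being frozen at 1; the factor [c]
    makes the image a cone. *)
Definition torus_image (j : nat) : pset J := fun v =>
  exists (c : Cplx) (x : T -> Cplx), [/\ c != 0, forall s, x s != 0,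
    forall s, s \notin take j l -> x s = 1 &
    forall a, v a = c * \prod_s x s ^+ E a s].

Hypothesis J_gt0 : (0 < #|J|)%N.

Lemma torus_image_nonzero j v : torus_image j v -> Defs.nonzero v.
Proof.
move=> [c [x [c0 x0 _ vE]]]; have /card_gt0P[a _] := J_gt0; exists a.
rewrite vE mulf_neq0 //; apply/prodf_neq0 => s _; exact: expf_neq0.
Qed.

Lemma pirreducible_torus_image j : pirreducible (pclosure (torus_image j)).
Proof.
apply: pirreducible_pclosure => [w|| v w]; first exact: torus_image_nonzero.
  exists (fun=> 1), 1, (fun=> 1); split=> // [||a]; rewrite ?oner_neq0 // => *.
  by rewrite big1 ?mulr1 // => s _; rewrite expr1n.
move=> [c [x [c0 x0 x1 vE]]] [c' [x' [c0' x0' x1' wE]]].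
(* Two points are joined by interpolating their parameters linearly; frozen parameters stay 1, and
   the product of all the [L] excludes the values where some parameter is zero. *)
pose L (y z : Cplx) : {poly Cplx} := y%:P + (z - y) *: 'X.
have LE y z s : (L y z).[s] = y + (z - y) * s by rewrite !hornerE.
have L0 y z : (L y z).[0] = y by rewrite LE mulr0 addr0.
have L1 y z : (L y z).[1] = z by rewrite LE mulr1 addrC subrK.
exists (fun a => L c c' * \prod_s L (x s) (x' s) ^+ E a s).
exists (L c c' * \prod_s L (x s) (x' s)); split.
- apply/eqP => /(congr1 (fun p => p.[0])); rewrite hornerM horner_prod L0 horner0.
  move/eqP; rewrite mulf_eq0 (negPf c0) /=; apply/negP/prodf_neq0 => s _.
  by rewrite L0.
- move=> a; rewrite hornerM horner_prod L0 vE; congr (_ * _).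
  by apply: eq_bigr => s _; rewrite horner_exp L0.
- move=> a; rewrite hornerM horner_prod L1 wE; congr (_ * _).
  by apply: eq_bigr => s _; rewrite horner_exp L1.
move=> t; rewrite hornerM horner_prod mulf_eq0 negb_or => /andP[Lc /prodf_neq0 Lx].
exists (L c c').[t], (fun s => (L (x s) (x' s)).[t]); split=> //.
- by move=> s; apply: Lx.
- by move=> s sl; rewrite LE x1 // x1' // subrr mul0r addr0.
move=> a; rewrite hornerM horner_prod; congr (_ * _).
by apply: eq_bigr => s _; rewrite horner_exp.
Qed.

Lemma torus_imageS j : psubset (torus_image j) (torus_image j.+1).
Proof.
move=> v [c [x [c0 x0 x1 vE]]]; exists c, x; split=> // s sl; apply: x1.
have -> : take j l = take j (take j.+1 l) by rewrite -take_min (minn_idPl (leqnSn j)).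
exact: contra (@mem_take _ _ _ _) sl.
Qed.

Lemma torus_image_full j : psubset (torus_image j) (torus_image (size l)).
Proof.
move=> v [c [x [c0 x0 x1 vE]]]; exists c, x; split=> // s sl; apply: x1.
by apply: contra sl; rewrite take_size; apply: mem_take.
Qed.

Lemma peval_monomial (al : J -> nat) (v : pt J) :
  peval 'X_[[multinom al (enum_val i) | i < #|J|]] v = \prod_a v a ^+ al a.
Proof.
rewrite /peval mevalX [RHS](reindex (@enum_val J predT)) /=; last first.
  by exists enum_rank => i _; rewrite ?enum_valK ?enum_rankK.
by apply: eq_bigr => i _; rewrite mnmE.
Qed.

Lemma mdeg_multinom (al : J -> nat) :
  mdeg [multinom al (enum_val i) | i < #|J|] = (\sum_a al a)%N.
Proof.
rewrite mdegE [RHS](reindex (@enum_val J predT)) /=; last first.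
  by exists enum_rank => i _; rewrite ?enum_valK ?enum_rankK.
by apply: eq_bigr => i _; rewrite mnmE.
Qed.

Lemma prod_monomial_map (al : J -> nat) (c : Cplx) (x : T -> Cplx) :
  \prod_a (c * \prod_s x s ^+ E a s) ^+ al a =
  c ^+ (\sum_a al a) * \prod_s x s ^+ (\sum_a al a * E a s).
Proof.
under eq_bigr do rewrite exprMn.
rewrite big_split /= expr_sum; congr (_ * _).
under eq_bigr do rewrite -prodrXl.
rewrite exchange_big /=; apply: eq_bigr => s _; rewrite expr_sum.
by apply: eq_bigr => a _; rewrite mulnC exprM.
Qed.

Hypothesis l_uniq : uniq l.
Hypothesis E_free : forall (w0 : rat) (w : T -> rat),
  (forall s, s \notin l -> w s = 0) ->
  (forall a, w0 + \sum_s w s * (E a s)%:R = 0) -> forall s, w s = 0.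

(** By [E_free], row [s1] is outside the span of the row of ones and the rows in [take j l]. A
    rational functional killing these but not row [s1] is scaled to integers and split as
    [al - be]. *)
Lemma binomial_exponents j s1 : s1 \in l -> s1 \notin take j l ->
  exists al be : J -> nat, [/\ (\sum_a al a = \sum_a be a)%N,
    forall s, s \in take j l -> (\sum_a al a * E a s = \sum_a be a * E a s)%N &
    (\sum_a al a * E a s1 != \sum_a be a * E a s1)%N].
Proof.
move=> s1l s1j.
pose M (i : unit + T) a : rat := match i with
  | inl _ => 1 | inr s => if s \in take j l then (E a s)%:R else 0 end.
have [|u [uM us1]] := @separating_functional _ _ _ M (fun a => (E a s1)%:R).
  move=> w; apply: NNPP => nw.
  (* If row [s1] were a combination of the others, moving it across with coefficient -1 would
     contradict [E_free]. *)
  pose w' s := if s == s1 then -1 else if s \in take j l then w (inr s) else 0.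
  suff : w' s1 = 0 by move/eqP; rewrite /w' eqxx oppr_eq0 oner_eq0.
  apply: (E_free (w0 := w (inl tt))) => [s sl|a].
    rewrite /w'; case: eqP => [ss1|_]; first by rewrite ss1 s1l in sl.
    by case: ifP => // /mem_take sl'; rewrite sl' in sl.
  have /eqP : \sum_i w i * M i a == (E a s1)%:R.
    by apply/negP => /negP h; apply: nw; exists a.
  rewrite big_sumType /= (big_pred1 tt) => [|[]//]; rewrite mulr1.
  rewrite (bigD1 s1) //= (negPf s1j) mulr0 add0r => h.
  rewrite (bigD1 s1) //= {1}/w' eqxx mulN1r -h opprD !addrA subrr add0r.
  rewrite addrC; apply/eqP; rewrite subr_eq0; apply/eqP; apply: eq_bigr => s ss1.
  by rewrite /w' (negPf ss1); case: ifP; rewrite ?mul0r ?mulr0.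
have [c [al [be [c0 cu]]]] := clear_denominators u.
have key (n : J -> nat) : ((\sum_a al a * n a)%N == (\sum_a be a * n a)%N) =
    (\sum_a (n a)%:R * u a == 0).
  rewrite -(inj_eq (mulfI c0)) mulr0 mulr_sumr -(eqr_nat rat) -subr_eq0.
  rewrite !natr_sum -sumrB; congr (_ == 0); apply: eq_bigr => a _.
  by rewrite mulrCA cu !natrM -mulrBl mulrC.
exists al, be; split.
- have muln1s (f : J -> nat) : (\sum_a f a * 1 = \sum_a f a)%N.
    by apply: eq_bigr => a _; rewrite muln1.
  rewrite -(muln1s al) -(muln1s be); apply/eqP; rewrite (key (fun=> 1%N)).
  by apply/eqP; rewrite -[RHS](uM (inl tt)); apply: eq_bigr.
- move=> s sj; apply/eqP; rewrite key; apply/eqP; rewrite -[RHS](uM (inr s)).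
  by apply: eq_bigr => a _; rewrite /= sj.
- by rewrite key.
Qed.

(** The form [X^al - X^be] vanishes on the smaller image, since frozen parameters contribute 1, but
    not at the point whose only parameter different from 1 is the newly freed [s1]. *)
Lemma torus_image_proper j : (j < size l)%N ->
  pproper (pclosure (torus_image j)) (pclosure (torus_image j.+1)).
Proof.
move=> jl; split=> [v vcl Z Zcl sub|].
  by apply: vcl => // w /torus_imageS; apply: sub.
have [s0 _] : {s0 : T | true} by case: (l) jl => // s0 ?; exists s0.
pose s1 := nth s0 l j.
have s1l : s1 \in l by apply: mem_nth.
have tS : take j.+1 l = rcons (take j l) s1 by apply: take_nth.
have s1j : s1 \notin take j l.
  by have := take_uniq j.+1 l_uniq; rewrite tS rcons_uniq => /andP[].
have [al [be [al_be al_be_j al_be_s1]]] := binomial_exponents s1l s1j.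
have [y [y0 yy]] := exists_expr_neq Cplx al_be_s1.
pose x s := if s == s1 then y else 1.
pose v : pt J := fun a => 1 * \prod_s x s ^+ E a s.
pose p : {mpoly Cplx[#|J|]} := 'X_[[multinom al (enum_val i) | i < #|J|]]
  - 'X_[[multinom be (enum_val i) | i < #|J|]].
have prodx n : \prod_s x s ^+ n s = y ^+ n s1.
  rewrite (bigD1 s1) //= /x eqxx big1 ?mulr1 // => s /negPf ->.
  by rewrite expr1n.
exists v; split.
  apply: sub_pclosure; exists 1, x; split=> //; first exact: oner_neq0.
    by move=> s; rewrite /x; case: ifP => _ //; apply: oner_neq0.
  by move=> s; rewrite tS mem_rcons inE negb_or /x => /andP[/negPf ->].
move/(pclosureE _ (@torus_image_nonzero j)) => [_ /(_ (\sum_a al a)%N p)].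
have ph : p \is (\sum_a al a)%N.-homog.
  by rewrite rpredB ?dhomogX //; apply/eqP; [|rewrite al_be]; apply: mdeg_multinom.
have pE w : peval p w = \prod_a w a ^+ al a - \prod_a w a ^+ be a.
  by rewrite -!peval_monomial /peval mevalB.
move/(_ ph); rewrite pE /v !prod_monomial_map !prodx !expr1n !mul1r => H.
suff /H/eqP : vanishes p (torus_image j) by rewrite subr_eq0 (negPf yy).
move=> w [c [z [_ _ z1 wE]]]; rewrite pE.
under eq_bigr do rewrite wE; under [in X in _ - X]eq_bigr do rewrite wE.
rewrite !prod_monomial_map al_be; apply/eqP; rewrite subr_eq0; apply/eqP.
congr (_ * _); apply: eq_bigr => s _.
have [sj|sj] := boolP (s \in take j l); first by rewrite al_be_j.
by rewrite z1 // !expr1n.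
Qed.

Lemma toric_chain X : pclosed X -> psubset (torus_image (size l)) X ->
  has_chain X (size l).
Proof.
move=> Xcl lX; exists (fun j => pclosure (torus_image j)); split=> j jl.
  split; first exact: pirreducible_torus_image.
  by apply: pclosure_sub => // v /torus_image_full/lX.
exact: torus_image_proper.
Qed.

End ToricChain.

(** * Comparison of the two terms of the minimum *)

Lemma leq_bin m k : (0 < k < m -> m <= 'C(m, k))%N.
Proof.
elim: m k => [|m IHm] [|k] //= km.
have [<-|mk] := eqVneq k.+1 m; first by rewrite binS binn binSn.
rewrite binS -addn1 leq_add ?IHm ?bin_gt0 //; lia.
Qed.

(** In the induction on [d], Pascal's rule adds some ['C(m, k)] with [n <= m] and [0 < k < m], hence
    at least [n]; this range of [k] is where [2 < n] enters. *)
Lemma mul_leq_bin n d : (2 < n -> 0 < d -> n * d <= 'C(n + d - 1, d))%N.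
Proof.
move=> n2; elim: d => // -[|d] IHd _; first by rewrite muln1 addnK bin1.
have -> : (n + d.+2 - 1 = (n + d.+1 - 1).+1)%N by lia.
rewrite binS mulnS leq_add ?IHd // -bin_sub; last lia.
apply: leq_trans (leq_bin _); lia.
Qed.

(** * The moment variety as a toric variety *)

Section Moments.
Variables n d : nat.

(** The 0/1 exponent matrix. The pair [(k, i)] stands for the moment of index [i.+1], as index 0 is
    fixed at 1. *)
Definition moment_exponent (a : midx n d) (s : 'I_n * 'I_d) : nat :=
  tnth (val a) s.1 == s.2.+1 :> nat.

Lemma midx_exists (h : 'I_n -> nat) : (\sum_k h k = d)%N ->
  exists a : midx n d, forall k, tnth (val a) k = h k :> nat.
Proof.
move=> hd; pose t := [tuple (inord (h k) : 'I_d.+1) | k < n].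
have tE k : tnth t k = h k :> nat.
  by rewrite tnth_mktuple inordK // ltnS -hd (bigD1 k) //= leq_addr.
have td : (\sum_(k < n) (tnth t k : nat) == d)%N.
  by rewrite -[eqbRHS]hd; apply/eqP/eq_bigr.
by exists (exist _ t td).
Qed.

Lemma sum_midx (a : midx n d) : (\sum_k tnth (val a) k = d)%N.
Proof. by apply/eqP; case: a. Qed.

Lemma card_midx_gt0 : (0 < n)%N -> (0 < #|midx n d|)%N.
Proof.
move=> n0; apply/card_gt0P.
have [|a _] := @midx_exists (fun k => if k == Ordinal n0 then d else 0%N).
  by rewrite -big_mkcond big_pred1_eq.
by exists a.
Qed.

Lemma moment_mapE (mu : 'I_n -> 'I_d.+1 -> Cplx) a : (forall k, mu k ord0 = 1) ->
  moment_map mu a = \prod_s mu s.1 (lift ord0 s.2) ^+ moment_exponent a s.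
Proof.
move=> mu1; rewrite -(pair_bigA _ (fun (k : 'I_n) (i : 'I_d) =>
  mu k (lift ord0 i) ^+ (tnth (val a) k == i.+1 :> nat))) /=.
apply: eq_bigr => k _; case: (unliftP ord0 (tnth (val a) k)) => [i ->|->]; last first.
  by rewrite mu1 big1.
rewrite (bigD1 i) //= eqxx expr1 big1 ?mulr1 // => j ji.
by rewrite /bump /= eqSS val_eqE eq_sym (negPf ji).
Qed.

Lemma moment_image_nonzero v : moment_image n d v -> Defs.nonzero v.
Proof.
move=> [mu [c [_ [c0 [[a nza] vE]]]]]; exists a; rewrite vE; exact: mulf_neq0.
Qed.

Lemma moment_image_conic : conic (@moment_image n d).
Proof.
move=> v b [mu [c [mu1 [c0 [nz vE]]]]] b0; exists mu, (b * c); do !split=> //.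
  exact: mulf_neq0.
by move=> a; rewrite vE mulrA.
Qed.

Lemma moment_variety_closed : pclosed (moment_variety n d).
Proof. exact: pclosed_pclosure moment_image_nonzero. Qed.

(* The scalar [c] is absorbed by replacing [mu k i] with [lam ^+ i * mu k i], where
   [lam ^+ d = c], as every coordinate has weight [d]. *)
Lemma moment_image_param v : (0 < d)%N -> moment_image n d v ->
  exists t : 'I_n * 'I_d -> Cplx,
    forall a, v a = \prod_s t s ^+ moment_exponent a s.
Proof.
move=> d0 [mu [c [mu1 [_ [_ vE]]]]].
have [lam lamE] := exists_expr_eq c d0.
pose mu' k (i : 'I_d.+1) := lam ^+ i * mu k i.
have mu'1 k : mu' k ord0 = 1 by rewrite /mu' mu1 mulr1.
exists (fun s => mu' s.1 (lift ord0 s.2)) => a.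
by rewrite -(moment_mapE _ mu'1) /moment_map big_split /= -expr_sum sum_midx lamE vE.
Qed.

Lemma moment_chain_lt k : (0 < d)%N -> has_chain (moment_variety n d) k ->
  (k < n * d)%N.
Proof.
move=> d0; have <- : #|{: 'I_n * 'I_d}| = (n * d)%N by rewrite card_prod !card_ord.
pose phi := [tuple \prod_s ('X_(enum_rank s) : {mpoly Cplx[#|{: 'I_n * 'I_d}|]})
  ^+ moment_exponent (enum_val i) s | i < #|midx n d|].
apply: (chain_length_lt (phi := phi) moment_image_nonzero moment_image_conic).
move=> v /(moment_image_param d0)[t vE]; exists (fun i => t (enum_val i)) => a.
rewrite tnth_mktuple enum_rankK vE rmorph_prod /=; apply: eq_bigr => s _.
by rewrite rmorphXn /= mevalXU enum_rankK.
Qed.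

(** Here the coordinates of the ambient space are the parameters, coordinate [a] being the variable
    [e a]; variables outside the range of [e] are set to 0. *)
Lemma moment_chain_lt_inj r (e : midx n d -> 'I_r) k :
  injective e -> has_chain (moment_variety n d) k -> (k < r)%N.
Proof.
move=> e_inj; pose phi := [tuple ('X_(e (enum_val i)) : {mpoly Cplx[r]}) | i < #|midx n d|].
apply: (chain_length_lt (phi := phi) moment_image_nonzero moment_image_conic) => v _.
exists (fun i => if [pick a | e a == i] is Some a then v a else 0) => a.
rewrite tnth_mktuple enum_rankK mevalXU; case: pickP => [b /eqP/e_inj -> //|/(_ a)].
by rewrite eqxx.
Qed.

Lemma moment_chain (l : seq ('I_n * 'I_d)) : (0 < n)%N -> uniq l ->
  (forall (w0 : rat) (w : 'I_n * 'I_d -> rat), (forall s, s \notin l -> w s = 0) ->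
    (forall a, w0 + \sum_s w s * (moment_exponent a s)%:R = 0) ->
    forall s, w s = 0) ->
  has_chain (moment_variety n d) (size l).
Proof.
move=> n0 ul free; have J0 := card_midx_gt0 n0.
apply: (toric_chain J0 ul free moment_variety_closed) => v [c [x [c0 x0 _ vE]]].
pose mu (k : 'I_n) (i : 'I_d.+1) := if unlift ord0 i is Some j then x (k, j) else 1.
have mu1 k : mu k ord0 = 1 by rewrite /mu unlift_none.
have muE a : moment_map mu a = \prod_s x s ^+ moment_exponent a s.
  by rewrite moment_mapE //; apply: eq_bigr => -[k i] _; rewrite /mu liftK.
apply: sub_pclosure; exists mu, c; do !split=> //; last by move=> a; rewrite muE.
have /card_gt0P[a _] := J0; exists a; rewrite muE; apply/prodf_neq0 => s _.
exact: expf_neq0.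
Qed.

(** Row [k] of a relation as a function on [[0..d]], extended by 0 at index 0; relations among
    exponent rows become identities over compositions of [d]. *)
Definition level_weight (w : 'I_n * 'I_d -> rat) k (i : nat) : rat :=
  \sum_(j < d) w (k, j) * (i == j.+1)%:R.

Lemma level_weight0 w k : level_weight w k 0 = 0.
Proof. by apply: big1 => j _; rewrite mulr0. Qed.

Lemma level_weightS w k (j : 'I_d) : level_weight w k j.+1 = w (k, j).
Proof.
rewrite /level_weight (bigD1 j) //= eqxx mulr1 big1 ?addr0 // => i ij.
by rewrite eqSS val_eqE eq_sym (negPf ij) mulr0.
Qed.

Lemma level_weight_relation w0 w :
  (forall a, w0 + \sum_s w s * (moment_exponent a s)%:R = 0) ->
  forall h : 'I_n -> nat, (\sum_k h k = d)%N ->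
  w0 + \sum_k level_weight w k (h k) = 0.
Proof.
move=> rel h /midx_exists[a aE]; rewrite -[RHS](rel a); congr (_ + _).
rewrite /level_weight pair_bigA; apply: eq_bigr => -[k j] _.
by rewrite /moment_exponent /= aE.
Qed.

End Moments.

(** * A functional equation on compositions of [d] *)

Definition three_point n (k l m : 'I_n) (i j p : nat) (x : 'I_n) : nat :=
  if x == k then i else if x == l then j else if x == m then p else 0%N.

Lemma big_three_point (R : Type) (idx : R) (op : Monoid.com_law idx) n
    (k l m : 'I_n) i j p (G : 'I_n -> nat -> R) :
  l != k -> m != k -> m != l -> (forall x, G x 0%N = idx) ->
  \big[op/idx]_x G x (three_point k l m i j p x) =
  op (G k i) (op (G l j) (G m p)).
Proof.
move=> lk mk ml G0; rewrite (bigD1 k) //= (bigD1 l) //= (bigD1 m) ?mk //=.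
rewrite big1 => [|x /andP[/andP[/negPf xk /negPf xl] /negPf xm]]; last first.
  by rewrite /three_point xk xl xm.
by rewrite Monoid.mulm1 /three_point eqxx (negPf lk) eqxx (negPf mk) (negPf ml) eqxx.
Qed.

Lemma exists_third n (k l : 'I_n) : (2 < n)%N -> exists m, (m != k) && (m != l).
Proof.
move=> n2; apply/existsP; apply: contraLR n2; rewrite negb_exists => /forallP all_kl.
have sub : [set: 'I_n] \subset [set k; l].
  apply/subsetP => m _; rewrite !inE; have := all_kl m.
  by rewrite negb_and !negbK.
rewrite -leqNgt -[n]card_ord -cardsT; apply: leq_trans (subset_leq_card sub) _.
by rewrite cards2; case: (k != l).
Qed.

(* The relations force all [W k] to coincide and to be additive on [0..d]; being zero
   at [d], they vanish. *)
Lemma moment_weights_eq0 n d (w0 : rat) (W : 'I_n -> nat -> rat) k0 :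
  (2 < n)%N -> (0 < d)%N -> (forall k, W k 0%N = 0) -> W k0 d = 0 ->
  (forall h : 'I_n -> nat, (\sum_k h k = d)%N -> w0 + \sum_k W k (h k) = 0) ->
  forall k i, (i <= d)%N -> W k i = 0.
Proof.
move=> n2 d0 W0 Wd rel.
have rel3 k l m i j p : l != k -> m != k -> m != l -> (i + (j + p) = d)%N ->
    w0 + (W k i + (W l j + W m p)) = 0.
  move=> lk mk ml ijp; rewrite -[RHS](rel (three_point k l m i j p)).
    by rewrite [in RHS]big_three_point.
  by rewrite (@big_three_point nat 0%N addn n k l m i j p (fun _ y => y)).
have [l0 /andP[l0k _]] := exists_third k0 k0 n2.
have [m0 /andP[m0k m0l]] := exists_third k0 l0 n2.
have w00 : w0 = 0.
  have := rel3 k0 l0 m0 d 0%N 0%N l0k m0k m0l (addn0 d).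
  by rewrite !W0 Wd !addr0.
have rel2 k l i : l != k -> (i <= d)%N -> W k i = - W l (d - i)%N.
  move=> lk id; have [m /andP[mk ml]] := exists_third k l n2.
  have := rel3 k l m i (d - i)%N 0%N lk mk ml; rewrite addn0 subnKC // => /(_ erefl).
  by rewrite w00 W0 add0r addr0 => /eqP; rewrite addr_eq0 => /eqP.
(* Rows [k] and [k0] have the same complement in a third row [m]. *)
have Wk k i : (i <= d)%N -> W k i = W k0 i.
  move=> id; have [m /andP[mk mk0]] := exists_third k k0 n2.
  by rewrite (rel2 k m) // (rel2 k0 m).
have add i j : (i + j <= d)%N -> W k0 (i + j)%N = W k0 i + W k0 j.
  move=> ijd; have := rel3 k0 l0 m0 i j (d - (i + j))%N l0k m0k m0l.
  rewrite addnA subnKC // w00 add0r (rel2 k0 m0 (i + j)%N) // (Wk l0) => [|]; last lia.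
  by move=> /(_ erefl)/eqP; rewrite addrA addr_eq0 => /eqP ->.
have lin i : (i <= d)%N -> W k0 i = i%:R * W k0 1%N.
  elim: i => [|i IHi] id; first by rewrite W0 mul0r.
  have := add i 1%N; rewrite addn1 => -> //.
  by rewrite IHi ?(ltnW id) // -natr1 mulrDl mul1r.
have W1 : W k0 1%N = 0.
  have := lin d (leqnn d); rewrite Wd => /esym/eqP; rewrite mulf_eq0 pnatr_eq0.
  by rewrite eqn0Ngt d0 => /eqP.
by move=> k i id; rewrite Wk // lin // W1 mulr0.
Qed.
End MomentVariety.

(** * The dimension formula, by cases on [n] *)

Theorem theorem4p1 (n d : nat) :
  (0 < n)%N -> (0 < d)%N ->
  pdim_eq (moment_variety n d) (minn (n * d - 1) ('C(n + d - 1, d) - 1)).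
Proof.
move=> n0 d0; have [n2|] := ltnP 2 n; last case: n n0 => [|[|[|]]] // _ _.
- have -> : minn (n * d - 1) ('C(n + d - 1, d) - 1) = (n * d).-1.
    by have := mul_leq_bin n2 d0; lia.
  split; last by move/(moment_chain_lt d0); rewrite prednK ?muln_gt0 ?n0 // ltnn.
  have d1 : d.-1 < d by rewrite prednK.
  (* The weighted sum of all exponent rows is the constant [d], so one parameter must be dropped:
     the top moment of the first row, which gives weight 0 at [d]. *)
  pose s0 : 'I_n * 'I_d := (Ordinal n0, Ordinal d1).
  have <- : size (enum (predC1 s0)) = (n * d).-1.
    by rewrite -cardE cardC1 card_prod !card_ord.
  apply: moment_chain => //; first exact: enum_uniq.
  move=> w0 w ws rel [k i].
  rewrite -level_weightS; apply: (@moment_weights_eq0 n d w0 _ (Ordinal n0)) => //.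
  + exact: level_weight0.
  + rewrite -[X in level_weight _ _ X](prednK d0) (level_weightS _ _ (Ordinal d1)).
    by apply: ws; rewrite mem_enum inE negbK.
  exact: level_weight_relation.
(* For [n = 1] there is a single coordinate, and the variety is a point. *)
- have -> : minn (1 * d - 1) ('C(1 + d - 1, d) - 1) = 0.
    by rewrite addnC addnK binn minn0.
  split; first by apply: (@moment_chain 1 d [::]) => // w0 w ws _ s; exact: ws.
  move/(@moment_chain_lt_inj 1 d 1 (fun=> ord0)) => h.
  suff /h : injective (fun _ : midx 1 d => ord0 : 'I_1) by [].
  move=> a b _; apply/val_inj/eq_from_tnth => k; apply/val_inj.
  have entry (c : midx 1 d) : tnth (val c) k = d :> nat.
    by rewrite -[RHS](sum_midx c) big_ord1 [k]ord1.
  exact: etrans (entry a) (esym (entry b)).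
(* For [n = 2] the ambient space has [d.+1] coordinates, indexed by the first entry, and the variety
   fills it. *)
have -> : minn (2 * d - 1) ('C(2 + d - 1, d) - 1) = d.
  have -> : 2 + d - 1 = d.+1 by lia.
  by rewrite binSn; lia.
split; last first.
  move/(@moment_chain_lt_inj 2 d d.+1 (fun a => tnth (val a) ord0)) => h.
  suff /h : injective (fun a : midx 2 d => tnth (val a) ord0) by rewrite ltnn.
  move=> a b ab; apply/val_inj/eq_from_tnth => k; apply/val_inj.
  have entries (c : midx 2 d) : tnth (val c) ord0 + tnth (val c) (lift ord0 ord0) = d.
    by rewrite -[RHS](sum_midx c) !big_ord_recl big_ord0 addn0.
  case: (unliftP ord0 k) => [j ->|->]; last by rewrite ab.
  have := etrans (entries a) (esym (entries b)); rewrite ab => /addnI.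
  by rewrite [j]ord1.
(* Freeing the first row alone already gives [d] independent parameters. *)
pose l : seq ('I_2 * 'I_d) := [seq (ord0, i) | i <- enum 'I_d].
have sl : size l = d by rewrite size_map size_enum_ord.
suff : has_chain (moment_variety 2 d) (size l) by rewrite sl.
apply: moment_chain => //; first by rewrite map_inj_uniq ?enum_uniq // => i j [].
move=> w0 w ws rel.
have wl j : w (lift ord0 ord0, j) = 0%R.
  by apply: ws; apply/mapP => -[].
have W1 i : level_weight w (lift ord0 ord0) i = 0%R.
  by apply: big1 => j _; rewrite wl GRing.mul0r.
(* On the composition [(i, d - i)] only the first row contributes; [i = 0] then gives [w0 = 0]. *)
have rel2 i : i <= d -> (w0 + level_weight w ord0 i = 0)%R.
  move=> id; pose h (k : 'I_2) := if k == ord0 then i else d - i.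
  have := level_weight_relation rel (h := h).
  rewrite !big_ord_recl !big_ord0 /h /= W1 !GRing.addr0 addn0 subnKC //.
  exact.
have w00 : w0 = 0%R by have := rel2 0 isT; rewrite level_weight0 GRing.addr0.
case=> k j; case: (unliftP ord0 k) => [k' ->|->]; first by rewrite [k']ord1 wl.
by have := rel2 j.+1 (ltn_ord j); rewrite w00 GRing.add0r level_weightS.
Qed.
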